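(* Let $n\ge1$ and let $S^{2n-1}\subset\mathbb R^{2n}$, with coordinates $(x,y)=(x_1,\dots,x_n,y_1,\dots,y_n)$, carry the uniform probability measure. For $U\in O_{2n}$ write $U\begin{pmatrix}x\\ y\end{pmatrix}=\begin{pmatrix}x'\\ y'\end{pmatrix}$ with $x',y'\in\mathbb R^n$ and define $\xi(U):S^{2n-1}\to\mathbb R$ by $\xi(U)=\sum_i x_i'^2-\sum_i y_i'^2$. Let $\rho\in O_{2n}$ be the $45^\circ$ rotation in each plane $(x_i,y_i)$, i.e. $\rho$ maps $(x_i,y_i)\mapsto\big((x_i+y_i)/\sqrt2,\,(y_i-x_i)/\sqrt2\big)$ for each $i$. Then the pair of random variables $(\xi(1),\xi(\rho))$ on $S^{2n-1}$ has the same joint distribution as the pair $(u_{11},u_{12})$ of matrix coordinates on $SO_{n+1}$ equipped with its Haar probability measure. *)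

(* Defs.v *)
From HB Require Import structures.
From mathcomp Require Import all_boot all_order all_algebra.
From mathcomp Require Import all_classical all_reals all_analysis.
From mathcomp Require Import measurable_realfun.

Set Implicit Arguments.
Unset Strict Implicit.
Unset Printing Implicit Defensive.

Import Order.TTheory GRing.Theory Num.Theory.
Import numFieldNormedType.Exports.

Local Open Scope classical_set_scope.
Local Open Scope ring_scope.

Notation borel T := (g_sigma_algebraType (@open T)).

Lemma continuous_borel_measurable (R : realType) (T : ptopologicalType)
  (f : T -> R) : continuous f -> measurable_fun [set: borel T] (f : borel T -> R).
Proof.
move=> /continuousP cf; apply: (measurability _ (RGenOpens.measurableE R)).
move=> _ [_ [a [b ->] <-]]; rewrite setTI; apply: sub_sigma_algebra.
exact/cf/interval_open.
Qed.

Section joint_variable.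
Context d d1 d2 (T : measurableType d) (T1 : measurableType d1)
  (T2 : measurableType d2).

Definition joint (X : {mfun T >-> T1}) (Y : {mfun T >-> T2}) (t : T) : T1 * T2 :=
  (X t, Y t).

Lemma measurable_joint X Y : measurable_fun [set: T] (joint X Y).
Proof. by apply: measurable_fun_pair; exact: measurable_funPT. Qed.

HB.instance Definition _ X Y :=
  isMeasurableFun.Build _ _ _ _ (joint X Y) (measurable_joint X Y).

End joint_variable.

Section orthogonal_groups.
Variables (R : realType) (d : nat).

Definition orthogonal_set : set 'M[R]_d := [set U | U^T *m U = 1%:M].

Definition orthogonal_group : Type := set_type orthogonal_set.

Lemma orthogonalP (U : orthogonal_group) : (sval U)^T *m sval U = 1%:M.
Proof. by have := svalP U; rewrite inE. Qed.

Lemma orthogonal1_subproof : 1%:M \in orthogonal_set.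
Proof. by rewrite inE /orthogonal_set /= trmx1 mulmx1. Qed.

Definition orthogonal1 : orthogonal_group := SigSub orthogonal1_subproof.

Definition SO_set : set 'M[R]_d := [set U | U^T *m U = 1%:M /\ \det U = 1].

Definition SO : Type := set_type SO_set.

HB.instance Definition _ := Topological.copy SO (set_type SO_set).

Lemma SO1_subproof : 1%:M \in SO_set.
Proof. by rewrite inE; split; rewrite ?trmx1 ?mulmx1 ?det1. Qed.

HB.instance Definition _ := isPointed.Build SO (SigSub SO1_subproof).

Lemma SO_mul_subproof (g h : SO) : sval g *m sval h \in SO_set.
Proof.
have [+ +] := (svalP g, svalP h); rewrite !inE => -[gO g1] [hO h1]; split.
  by rewrite trmx_mul mulmxA -(mulmxA _ _ (sval g)) gO mulmx1 hO.
by rewrite det_mulmx g1 h1 mulr1.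
Qed.

Definition SO_mul (g h : SO) : SO := SigSub (SO_mul_subproof g h).

Definition SO_coord (i j : 'I_d) (g : borel SO) : R := sval g i j.

Lemma measurable_SO_coord i j : measurable_fun setT (SO_coord i j).
Proof.
apply: continuous_borel_measurable => g.
apply: (@continuous_comp _ _ _ (sval : SO -> 'M[R]_d) (fun M => M i j)).
  exact: (@initial_continuous (set_type SO_set) _ set_val).
exact: coord_continuous.
Qed.

HB.instance Definition _ i j :=
  isMeasurableFun.Build _ _ _ _ (SO_coord i j) (measurable_SO_coord i j).

(* SO(d) is compact, so a left-invariant Borel probability measure is the Haar
   probability measure; it is automatically right-invariant and regular. *)
Definition is_Haar (nu : probability (borel SO) R) : Prop :=
  forall (g : SO) (B : set (borel SO)), measurable B ->
    nu (SO_mul g @^-1` B) = nu B.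

End orthogonal_groups.
Arguments orthogonal_set : clear implicits.
Arguments SO_set : clear implicits.

Section sphere.
Variables (R : realType) (n : nat).

Definition sphere_set : set 'cV[R]_(n + n) :=
  [set v | \sum_i v i 0 ^+ 2 = 1].

(* S^{2n-1}, inside R^{2n} = R^n x R^n; it is nonempty only for n >= 1. *)
Definition sphere : Type := set_type sphere_set.

HB.instance Definition _ := Topological.copy sphere (set_type sphere_set).

Lemma sphere_act_subproof (U : orthogonal_group R (n + n)) (p : sphere) :
  sval U *m sval p \in sphere_set.
Proof.
have sumE (v : 'cV[R]_(n + n)) : \sum_i v i 0 ^+ 2 = (v^T *m v) 0 0.
  by rewrite mxE; apply: eq_bigr => i _; rewrite mxE expr2.
have := svalP p; rewrite !inE /sphere_set /= !sumE trmx_mul mulmxA.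
by rewrite -(mulmxA _ _ (sval U)) orthogonalP mulmx1.
Qed.

Definition sphere_act (U : orthogonal_group R (n + n)) (p : sphere) : sphere :=
  SigSub (sphere_act_subproof U p).

(* The rotation (x_i, y_i) |-> ((x_i + y_i)/sqrt 2, (y_i - x_i)/sqrt 2). *)
Definition rho_mx : 'M[R]_(n + n) :=
  (Num.sqrt 2)^-1 *: block_mx 1%:M 1%:M (- 1%:M) 1%:M.

Lemma rho_subproof : rho_mx \in orthogonal_set R (n + n).
Proof.
rewrite inE /orthogonal_set /= /rho_mx.
rewrite [X in X *m _]linearZ /= -scalemxAl -scalemxAr scalerA.
have -> : (block_mx 1%:M 1%:M (- 1%:M) 1%:M : 'M[R]_(n + n))^T *m
    block_mx 1%:M 1%:M (- 1%:M) 1%:M = 2%:M.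
  rewrite tr_block_mx [(- _)^T]linearN /= trmx1 mulmx_block !mulmx1 !mul1mx.
  rewrite !mulNmx !mulmxN !mul1mx ?mulmx1 opprK addrN -raddfD /=.
  by rewrite [RHS]scalar_mx_block.
rewrite scale_scalar_mx -expr2 exprVn sqr_sqrtr ?ler0n//.
by rewrite mulVf ?pnatr_eq0.
Qed.

Definition rho : orthogonal_group R (n + n) := SigSub rho_subproof.

End sphere.
Arguments sphere_set : clear implicits.

Section sphere_probability.
Variables (R : realType) (n : nat).

Lemma sphere_point_subproof :
  (delta_mx 0 0 : 'cV[R]_(n.+1 + n.+1)) \in sphere_set R n.+1.
Proof.
rewrite inE /sphere_set /= (bigD1 0) //= big1 ?addr0 => [|i i0].
  by rewrite mxE !eqxx expr1n.
by rewrite mxE (negbTE i0) expr0n.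
Qed.

HB.instance Definition _ :=
  isPointed.Build (sphere R n.+1) (SigSub sphere_point_subproof).

(* The uniform probability measure of the sphere is its unique Borel
   probability measure invariant under the orthogonal group. *)
Definition is_uniform (mu : probability (borel (sphere R n.+1)) R) : Prop :=
  forall (U : orthogonal_group R (n.+1 + n.+1))
    (B : set (borel (sphere R n.+1))),
    measurable B -> mu (sphere_act U @^-1` B) = mu B.

(* usubmx q and dsubmx q are x' and y', for q the column (x', y'). *)
Definition xi (U : orthogonal_group R (n.+1 + n.+1))
    (p : borel (sphere R n.+1)) : R :=
  let q := sval U *m sval p in
  \sum_i usubmx q i 0 ^+ 2 - \sum_i dsubmx q i 0 ^+ 2.

Lemma measurable_xi U : measurable_fun setT (xi U).
Proof.
have mq i : measurable_fun setT
    (fun p : borel (sphere R n.+1) => (sval U *m sval p) i 0).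
  under eq_fun do rewrite mxE.
  apply: measurable_sum => j; apply: measurable_funM => //.
  apply: continuous_borel_measurable => p.
  apply: (@continuous_comp _ _ _
    (sval : sphere R n.+1 -> 'cV[R]_(n.+1 + n.+1)) (fun M => M j 0)).
    exact: (@initial_continuous (set_type (sphere_set R _)) _ set_val).
  exact: coord_continuous.
apply: measurable_funB; apply: measurable_sum => i;
  under eq_fun do rewrite mxE; exact: measurable_funX.
Qed.

HB.instance Definition _ U :=
  isMeasurableFun.Build _ _ _ _ (xi U) (measurable_xi U).

End sphere_probability.

(* Main.v *)
Require Import Defs.
From mathcomp Require Import all_boot all_order all_algebra.
From mathcomp Require Import all_classical all_reals all_analysis.
From mathcomp Require Import measurable_realfun ring lra zify.

(* Both pairs (X, Y) take values in [-1, 1]^2, so they are determined by their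
   moments M a b = E (X^a Y^b). For N = n + 1, on both sides,
     (N + a + b) M (a + 1) b = a M (a - 1) b,
   and the same holds with X and Y exchanged. These recurrences come from
   E (L f) = 0 for the generators L of rotations, with
   - on the sphere, X = <v, S v>, Y = <v, S' v>, where S, S' are symmetric,
     traceless and orthogonal and anticommute: f_ij = (S v)_i v_j X^a Y^b,
     summed over all i, j;
   - on SO, with left multiplication mixing rows 0 and j of the matrix u:
     f_j = u_j0 X^a Y^b, where X = u_00 and Y = u_01, summed over j != 0. *)

Set Implicit Arguments.
Unset Strict Implicit.
Unset Printing Implicit Defensive.

Import Order.TTheory GRing.Theory Num.Theory.
Import numFieldNormedType.Exports.

Local Open Scope classical_set_scope.
Local Open Scope ring_scope.

(** * Step functions as bounded limits of polynomials *)

Section step_approximation.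
Variable R : realType.
Implicit Types (x y z a : R) (m : nat).

Lemma bernoulli_ineq (u : R) k : -1 <= u -> 1 + u *+ k <= (1 + u) ^+ k.
Proof.
move=> u1; elim: k => [|k IH]; first by rewrite mulr0n addr0 expr0.
rewrite exprSr; have u0 : 0 <= 1 + u by lra.
apply: le_trans (ler_wpM2r u0 IH).
rewrite mulrDl mul1r mulrDr mulr1 mulrS.
have : 0 <= u *+ k * u by rewrite mulrnAl mulrn_wge0// -expr2 sqr_ge0.
lra.
Qed.

(** With [w = sqrt z], the sequence is [m w^m] times [w^m]. Bernoulli's inequality for
    [1 / w = 1 + h] bounds the first factor by [1 / h], and the second tends to 0. *)
Lemma cvg_natmul_expr z : 0 <= z < 1 -> (z ^+ m *+ m) @[m --> \oo] --> (0 : R).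
Proof.
move=> /andP[z0 z1].
have [->|zN0] := eqVneq z 0.
  rewrite [X in X @ _](_ : _ = fun=> 0); first exact: cvg_cst.
  by apply/funext => -[|m]; rewrite ?mulr0n// expr0n mul0rn.
have zp : 0 < z by rewrite lt_def zN0.
pose w := Num.sqrt z.
have wp : 0 < w by rewrite sqrtr_gt0.
have w1 : w < 1 by rewrite -(sqrtr1 R) ltr_sqrt.
pose h := w^-1 - 1.
have hp : 0 < h by rewrite subr_gt0 invf_gt1.
have mw m : w ^+ m *+ m <= h^-1.
  rewrite -(ler_pM2l hp) mulfV ?gt_eqF//.
  have B : 1 + h *+ m <= (1 + h) ^+ m by apply: bernoulli_ineq; lra.
  rewrite mulrnAr -mulrnAl.
  have wm : 0 < w ^+ m by rewrite exprn_gt0.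
  apply: (@le_trans _ _ ((1 + h) ^+ m * w ^+ m)).
    by rewrite ler_pM2r//; lra.
  by rewrite -exprMn /h addrC subrK mulVf ?gt_eqF// expr1n.
have C : (h^-1 * w ^+ m) @[m --> \oo] --> (0 : R).
  rewrite -[X in _ --> X](mulr0 h^-1); apply: cvgMr; apply: cvg_expr.
  by rewrite ger0_norm// ltW.
apply: (@squeeze_cvgr _ _ _ _ (fun=> 0) (fun m => h^-1 * w ^+ m)) => //;
  last exact: cvg_cst.
apply: nearW => m; rewrite mulrn_wge0 ?exprn_ge0//=.
rewrite -(sqr_sqrtr z0) -/w -exprM mulnC exprM expr2 -mulrnAl.
by rewrite ler_pM2r ?exprn_gt0.
Qed.

(** The outer exponent times [y ^+ m] is [m (2 y)^m], which tends to 0 for [y < 1/2] and to infinity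
    for [y >= 1/2]. The factor [m] forces the limit 0 at [y = 1/2] itself; without it the limit
    there would be [1/e]. *)
Definition step_poly m : {poly R} := (1 - 'X^m) ^+ (m * 2 ^ m).

Lemma step_polyE m y : (step_poly m).[y] = (1 - y ^+ m) ^+ (m * 2 ^ m).
Proof. by rewrite !hornerE. Qed.

Lemma step_poly_itv m y : 0 <= y <= 1 -> 0 <= (step_poly m).[y] <= 1.
Proof.
move=> /andP[y0 y1]; rewrite step_polyE.
have ym0 : 0 <= y ^+ m by rewrite exprn_ge0.
have ym1 : y ^+ m <= 1 by rewrite exprn_ile1.
by rewrite exprn_ge0 ?exprn_ile1//; lra.
Qed.

(* Bernoulli's inequality bounds the polynomial from below by
   [1 - m (2 y)^m]; for [y >= 1/2], applied to [(1 + 2^-m) ^+ (m 2^m)], it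
   bounds the polynomial from above by [1 / (1 + m)]. *)
Lemma cvg_step_poly y : 0 <= y <= 1 ->
  (step_poly m).[y] @[m --> \oo] --> ((y < 2^-1)%R%:R : R).
Proof.
move=> /andP[y0 y1]; have st m := step_poly_itv m (introT andP (conj y0 y1)).
case: ltP => hy.
  have z : 0 <= 2 * y < 1 by lra.
  apply: (@squeeze_cvgr _ _ _ _ (fun m => 1 - (2 * y) ^+ m *+ m) (fun=> 1));
    last 2 first.
  - rewrite -[X in _ --> X]subr0; apply: cvgB; first exact: cvg_cst.
    exact: cvg_natmul_expr.
  - exact: cvg_cst.
  apply: nearW => m; have /andP[_ ->] := st m; rewrite andbT step_polyE.
  have ym1 : y ^+ m <= 1 by rewrite exprn_ile1.
  have := @bernoulli_ineq (- y ^+ m) (m * 2 ^ m).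
  rewrite lerN2 => /(_ ym1); apply: le_trans.
  rewrite mulNrn lerD2l lerN2 mulnC mulrnA lerMn2r; apply/orP; right.
  by rewrite exprMn -natrX mulr_natl.
apply: (@squeeze_cvgr _ _ _ _ (fun=> 0) (fun m => m.+1%:R^-1)); last 2 first.
- exact: cvg_cst.
- exact: cvg_harmonic.
apply: nearW => m; have /andP[-> _] := st m; rewrite /= step_polyE.
pose u : R := 2^-1 ^+ m.
have u0 : 0 < u by rewrite exprn_gt0.
have u1 : u <= 1 by rewrite exprn_ile1//; lra.
have uy : u <= y ^+ m by rewrite lerXn2r// ?nnegrE//; lra.
have ym1 : y ^+ m <= 1 by rewrite exprn_ile1.
apply: (@le_trans _ _ ((1 - u) ^+ (m * 2 ^ m))).
  by rewrite lerXn2r ?nnegrE//; lra.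
rewrite -[leRHS]mul1r ler_pdivlMr ?ltr0n//.
have B : m.+1%:R <= (1 + u) ^+ (m * 2 ^ m).
  apply: le_trans (bernoulli_ineq _ _); last lra.
  rewrite mulnC mulrnA -(mulr_natl u) natrX -exprMn mulfV ?pnatr_eq0// expr1n.
  by rewrite -natr1 addrC.
(* What remains is a power of [(1 - u) (1 + u) = 1 - u ^+ 2], which lies in [0, 1]. *)
apply: le_trans (ler_wpM2l _ B) _; first by rewrite exprn_ge0//; lra.
rewrite -exprMn exprn_ile1//; nra.
Qed.

(** The affine substitution is increasing, sends [a] to the threshold 1/2 and maps [-1, 1] into
    [0, 1], where the step polynomials are controlled. *)
Definition ray_poly a m : {poly R} :=
  step_poly m \Po (2^-1%:P + (2 * (1 + `|a|))^-1 *: ('X - a%:P)).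

Lemma ray_poly_arg a x : `|x| <= 1 ->
  0 <= 2^-1 + (2 * (1 + `|a|))^-1 * (x - a) <= 1.
Proof.
move=> x1; have a0 := normr_ge0 a.
set c := (2 * _)^-1; have cp : 0 < c by rewrite invr_gt0; lra.
have cE : c * (1 + `|a|) = 2^-1.
  by rewrite /c invfM mulrC mulrCA mulfV ?mulr1// gt_eqF//; lra.
have : `|x - a| <= 1 + `|a| by rewrite (le_trans (ler_normB _ _))// lerD2r.
rewrite ler_norml => /andP[h1 h2].
have := ler_wpM2l (ltW cp) h1; have := ler_wpM2l (ltW cp) h2.
rewrite mulrN cE; lra.
Qed.

Lemma ray_polyE a m x :
  (ray_poly a m).[x] = (step_poly m).[2^-1 + (2 * (1 + `|a|))^-1 * (x - a)].
Proof. by rewrite horner_comp !hornerE. Qed.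

Lemma ray_poly_itv a m x : `|x| <= 1 -> 0 <= (ray_poly a m).[x] <= 1.
Proof. by move=> x1; rewrite ray_polyE step_poly_itv// ray_poly_arg. Qed.

Lemma cvg_ray_poly a x : `|x| <= 1 ->
  (ray_poly a m).[x] @[m --> \oo] --> ((x < a)%R%:R : R).
Proof.
move=> x1; under eq_cvg do rewrite ray_polyE.
have := cvg_step_poly (ray_poly_arg a x1).
rewrite -ltrBrDl subrr pmulr_rlt0 ?subr_lt0// invr_gt0.
Qed.

End step_approximation.

(** * Bounded laws on the plane are determined by their moments *)

Section bounded_measurable.
Context d (T : measurableType d) (R : realType) (P : probability T R).
Implicit Types f g : T -> R.

(** An algebra of functions, integrable for every probability measure: expectations of polynomial
    expressions can be expanded by linearity with no further integrability argument. *)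
Definition bmfun f :=
  measurable_fun setT f /\ exists C, forall x, `|f x| <= C.

Lemma bmfun_cst (c : R) : bmfun (fun=> c).
Proof. by split => //; exists `|c|. Qed.

Lemma bmfunD f g : bmfun f -> bmfun g -> bmfun (fun x => f x + g x).
Proof.
move=> [mf [C fC]] [mg [D gD]]; split; first exact: measurable_funD.
by exists (C + D) => x; rewrite (le_trans (ler_normD _ _))// lerD.
Qed.

Lemma bmfunM f g : bmfun f -> bmfun g -> bmfun (fun x => f x * g x).
Proof.
move=> [mf [C fC]] [mg [D gD]]; split; first exact: measurable_funM.
by exists (C * D) => x; rewrite normrM ler_pM.
Qed.

Lemma bmfunZ (c : R) f : bmfun f -> bmfun (fun x => c * f x).
Proof. exact: bmfunM (bmfun_cst c). Qed.

Lemma bmfunX f k : bmfun f -> bmfun (fun x => f x ^+ k).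
Proof.
move=> bf; elim: k => [|k IH].
  by under eq_fun do rewrite expr0; exact: bmfun_cst.
by under eq_fun do rewrite exprS; exact: bmfunM.
Qed.

Lemma bmfun_sum I (r : seq I) (p : pred I) (F : I -> T -> R) :
  (forall i, p i -> bmfun (F i)) -> bmfun (fun x => \sum_(i <- r | p i) F i x).
Proof.
move=> bF; elim: r => [|i r IH].
  by under eq_fun do rewrite big_nil; exact: bmfun_cst.
under eq_fun do rewrite big_cons; case pi: (p i) => //.
by apply: bmfunD => //; exact: bF.
Qed.

Lemma bmfun_horner (p : {poly R}) f : bmfun f -> bmfun (fun x => p.[f x]).
Proof.
move=> bf; elim/poly_ind: p => [|p c IH].
  by under eq_fun do rewrite horner0; exact: bmfun_cst.
under eq_fun do rewrite hornerMXaddC.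
by apply: bmfunD (bmfun_cst c); exact: bmfunM.
Qed.

Lemma bmfun_integrable f : bmfun f -> P.-integrable setT (EFin \o f).
Proof.
move=> [mf [C fC]]; apply: measurable_bounded_integrable => //.
  by rewrite (le_lt_trans (probability_le1 P measurableT))// ltry.
exists C; split; first exact: num_real.
by move=> M CM x _ /=; rewrite (le_trans (fC x)) ?ltW.
Qed.

Definition mean f : R := \int[P]_x f x.

Lemma mean_cst (c : R) : mean (fun=> c) = c.
Proof. by rewrite /mean Rintegral_cst//= probability_setT mulr1. Qed.

Lemma meanD f g : bmfun f -> bmfun g ->
  mean (fun x => f x + g x) = mean f + mean g.
Proof.
by move=> bf bg; rewrite /mean RintegralD//; exact: bmfun_integrable.
Qed.

Lemma meanZ (c : R) f : bmfun f -> mean (fun x => c * f x) = c * mean f.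
Proof. by move=> bf; rewrite /mean RintegralZl//; exact: bmfun_integrable. Qed.

Lemma mean_sum I (r : seq I) (p : pred I) (F : I -> T -> R) :
  (forall i, p i -> bmfun (F i)) ->
  mean (fun x => \sum_(i <- r | p i) F i x) = \sum_(i <- r | p i) mean (F i).
Proof.
move=> bF; elim: r => [|i r IH].
  by under eq_fun do rewrite big_nil; rewrite big_nil mean_cst.
under eq_fun do rewrite big_cons; rewrite big_cons; case pi: (p i) => //.
by rewrite meanD ?IH//; [exact: bF|exact: bmfun_sum].
Qed.

Lemma norm_mean_le (C : R) f : bmfun f -> (forall x, `|f x| <= C) ->
  `|mean f| <= C.
Proof.
move=> bf fC.
apply: le_trans (le_normr_Rintegral measurableT (bmfun_integrable bf)) _.
rewrite -[leRHS]mean_cst /mean le_Rintegral//.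
- by apply: bmfun_integrable; case: bf => mf ?; split;
    [exact: measurableT_comp|exists C => x; rewrite normr_id].
- exact/bmfun_integrable/bmfun_cst.
Qed.

End bounded_measurable.

Ltac bm := first [exact: bmfun_cst | exact: bmfun_horner | exact: bmfunX |
  apply: bmfunD | apply: bmfunM].

(** * From moments to polynomials and to quadrant probabilities *)

Section moment_problem.
Context d (T : measurableType d) d' (T' : measurableType d') (R : realType).
Variables (P : probability T R) (P' : probability T' R).

(** Open quadrants are stable under intersection, exhaust the plane along the diagonal and generate
    its product sigma-algebra, so the uniqueness theorem for measures applies. *)
Lemma open_quadrant_unique (m1 m2 : probability (R * R)%type R) :
  (forall a b, m1 (`]-oo, a[ `*` `]-oo, b[) = m2 (`]-oo, a[ `*` `]-oo, b[)) ->
  forall A, measurable A -> m1 A = m2 A.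
Proof.
move=> m12 A mA.
pose G : set (set (R * R)) :=
  [set X | exists a b, X = `]-oo, a[ `*` `]-oo, b[].
have setIG : setI_closed G.
  move=> _ _ [a [b ->]] [a' [b' ->]]; exists (Num.min a a'), (Num.min b b').
  apply/seteqP; split => -[x y] /=; rewrite !in_itv/= !lt_min.
    by move=> [[-> ->] [-> ->]].
  by move=> [/andP[-> ->] /andP[-> ->]].
have cover (z : R) : exists k : nat, z < k%:R.
  by exists (Num.bound `|z|); rewrite (le_lt_trans (ler_norm z))// archi_boundP.
have mG : measurable = <<s G >>.
  apply/seteqP; split; last first.
    apply: smallest_sub; first exact: sigma_algebra_measurable.
    by move=> _ [a [b ->]]; exact: measurableX.
  apply: smallest_sub; first exact: smallest_sigma_algebra.
  (* It suffices that both projections are measurable for the generated sigma-algebra; an open half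
     plane is a countable union of quadrants. *)
  have mfst : measurable_fun setT (fst : g_sigma_algebraType G -> R).
    apply: (measurability _ (RGenInftyO.measurableE R)) => _ [_ [a ->] <-].
    rewrite setTI [X in measurable X](_ : _ =
        \bigcup_k (`]-oo, a[ `*` `]-oo, k%:R[)); last first.
      apply/seteqP; split => -[x y] /=; rewrite !in_itv/=.
        by move=> xa; have [k yk] := cover y; exists k => //=; rewrite !in_itv.
      by move=> [k _ []] /=; rewrite !in_itv.
    apply: bigcup_measurable => k _; apply: sub_sigma_algebra.
    by exists a, k%:R.
  have msnd : measurable_fun setT (snd : g_sigma_algebraType G -> R).
    apply: (measurability _ (RGenInftyO.measurableE R)) => _ [_ [b ->] <-].
    rewrite setTI [X in measurable X](_ : _ =
        \bigcup_k (`]-oo, k%:R[ `*` `]-oo, b[)); last first.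
      apply/seteqP; split => -[x y] /=; rewrite !in_itv/=.
        by move=> xa; have [k yk] := cover x; exists k => //=; rewrite !in_itv.
      by move=> [k _ []] /=; rewrite !in_itv.
    apply: bigcup_measurable => k _; apply: sub_sigma_algebra.
    by exists k%:R, b.
  rewrite subUset; split=> _ [B mB <-]; [exact: mfst|exact: msnd].
apply: (measure_unique G (fun k => `]-oo, k%:R[ `*` `]-oo, k%:R[)) => //.
- by move=> k; exists k%:R, k%:R.
- apply/seteqP; split => // -[x y] _.
  have [k] := cover (Num.max x y); rewrite gt_max => /andP[xk yk].
  by exists k => //=; rewrite !in_itv.
- by move=> _ [a [b ->]]; exact: m12.
- move=> k; apply: (@le_lt_trans _ _ 1%E); last by rewrite ltry.
  by apply: probability_le1; exact: measurableX.
Qed.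

Variables (X Y : {mfun T >-> R}) (X' Y' : {mfun T' >-> R}).
Hypotheses (X1 : forall t, `|X t| <= 1) (Y1 : forall t, `|Y t| <= 1).
Hypotheses (X'1 : forall t, `|X' t| <= 1) (Y'1 : forall t, `|Y' t| <= 1).
Hypothesis eq_moments : forall i j,
  mean P (fun t => X t ^+ i * Y t ^+ j) =
  mean P' (fun t => X' t ^+ i * Y' t ^+ j).

Let bX : bmfun X. Proof. by split => //; exists 1. Qed.
Let bY : bmfun Y. Proof. by split => //; exists 1. Qed.
Let bX' : bmfun X'. Proof. by split => //; exists 1. Qed.
Let bY' : bmfun Y'. Proof. by split => //; exists 1. Qed.

(** Induction on [p], then on [q], along Horner's scheme. The statement carries extra powers of the
    variables, since each multiplication by ['X] raises an exponent. *)
Lemma eq_mean_poly (p q : {poly R}) :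
  mean P (fun t => p.[X t] * q.[Y t]) = mean P' (fun t => p.[X' t] * q.[Y' t]).
Proof.
have E1 : forall i j, mean P (fun t => p.[X t] * X t ^+ i * Y t ^+ j) =
    mean P' (fun t => p.[X' t] * X' t ^+ i * Y' t ^+ j).
  elim/poly_ind: (p) => [|r c IH] i j.
    under eq_fun do rewrite horner0 !mul0r.
    by under [in RHS]eq_fun do rewrite horner0 !mul0r; rewrite !mean_cst.
  have E x y : (r * 'X + c%:P).[x] * x ^+ i * y ^+ j =
      r.[x] * x ^+ i.+1 * y ^+ j + c * (x ^+ i * y ^+ j) :> R.
    by rewrite hornerMXaddC exprS; ring.
  under eq_fun do rewrite E; under [in RHS]eq_fun do rewrite E.
  rewrite !meanD ?meanZ ?IH ?eq_moments//;
  by repeat bm.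
have E2 : forall j, mean P (fun t => p.[X t] * q.[Y t] * Y t ^+ j) =
    mean P' (fun t => p.[X' t] * q.[Y' t] * Y' t ^+ j).
  elim/poly_ind: (q) => [|r c IH] j.
    under eq_fun do rewrite horner0 mulr0 mul0r.
    by under [in RHS]eq_fun do rewrite horner0 mulr0 mul0r; rewrite !mean_cst.
  (* The factor [x ^+ 0] gives the constant term the shape of [E1] with exponent 0. *)
  have E x y : p.[x] * (r * 'X + c%:P).[y] * y ^+ j =
      p.[x] * r.[y] * y ^+ j.+1 + c * (p.[x] * x ^+ 0 * y ^+ j) :> R.
    by rewrite hornerMXaddC exprS expr0; ring.
  under eq_fun do rewrite E; under [in RHS]eq_fun do rewrite E.
  rewrite !meanD ?meanZ ?IH ?E1//;
  by repeat bm.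
have := E2 0%N; under eq_fun do rewrite expr0 mulr1.
by under [in RHS]eq_fun do rewrite expr0 mulr1.
Qed.

End moment_problem.

(** Dominated convergence with bound 1: the product of the two ray polynomials converges at every
    point to the indicator of the quadrant, including on its boundary lines, where the limit is
    0. *)
Lemma cvg_mean_ray d (T : measurableType d) (R : realType)
    (P : probability T R) (X Y : {mfun T >-> R}) (a b : R) :
  (forall t, `|X t| <= 1) -> (forall t, `|Y t| <= 1) ->
  (mean P (fun t => (ray_poly a m).[X t] * (ray_poly b m).[Y t]))%:E
    @[m --> \oo] --> distribution P (joint X Y) (`]-oo, a[ `*` `]-oo, b[).
Proof.
move=> X1 Y1; set Q := _ `*` _.
have bX : bmfun X by split => //; exists 1.
have bY : bmfun Y by split => //; exists 1.
have mQ : measurable (joint X Y @^-1` Q).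
  rewrite -[_ @^-1` _]setTI; apply: measurable_funP => //.
  exact: measurableX.
have -> : distribution P (joint X Y) Q =
    (\int[P]_x (\1_(joint X Y @^-1` Q) x)%:E)%E.
  by rewrite integral_indic// setIT.
have bpq m : bmfun (fun t => (ray_poly a m).[X t] * (ray_poly b m).[Y t]).
  by apply: bmfunM; exact: bmfun_horner.
have mE m : (mean P (fun t => (ray_poly a m).[X t] * (ray_poly b m).[Y t]))%:E =
    (\int[P]_t ((ray_poly a m).[X t] * (ray_poly b m).[Y t])%:E)%E.
  rewrite /mean /Rintegral fineK//.
  by apply: integrable_fin_num => //; exact: bmfun_integrable.
under eq_cvg do rewrite mE.
have [|||||_ _ //] := @dominated_convergence _ T R P setT measurableT
  (fun m t => ((ray_poly a m).[X t] * (ray_poly b m).[Y t])%:E)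
  (fun t => (\1_(joint X Y @^-1` Q) t)%:E) (cst 1%E).
- by move=> m; apply/measurable_EFinP; case: (bpq m).
- by apply/measurable_EFinP; exact: measurable_indic.
- apply: aeW => t _; apply: cvg_EFin; first by apply: nearW.
  have -> : \1_(joint X Y @^-1` Q) t = (X t < a)%R%:R * (Y t < b)%R%:R :> R.
    rewrite indicE -natrM mulnb; congr ((_ : bool)%:R).
    apply/idP/idP => [/set_mem|/andP[Xa Yb]].
      by rewrite /Q/= !in_itv/= => -[-> ->].
    by apply/mem_set; rewrite /Q/= !in_itv.
  by apply: cvgM; exact: cvg_ray_poly.
- exact/bmfun_integrable/bmfun_cst.
- apply: aeW => t m _; rewrite abse_EFin lee_fin.
  have /andP[p0 p1] := ray_poly_itv a m (X1 t).
  have /andP[q0 q1] := ray_poly_itv b m (Y1 t).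
  by rewrite ger0_norm ?mulr_ge0// mulr_ile1.
Qed.

Lemma eq_distribution_moments d (T : measurableType d) d'
    (T' : measurableType d') (R : realType) (P : probability T R)
    (P' : probability T' R) (X Y : {mfun T >-> R}) (X' Y' : {mfun T' >-> R}) :
  (forall t, `|X t| <= 1) -> (forall t, `|Y t| <= 1) ->
  (forall t, `|X' t| <= 1) -> (forall t, `|Y' t| <= 1) ->
  (forall i j, mean P (fun t => X t ^+ i * Y t ^+ j) =
               mean P' (fun t => X' t ^+ i * Y' t ^+ j)) ->
  forall A : set (R * R), measurable A ->
    distribution P (joint X Y) A = distribution P' (joint X' Y') A.
Proof.
move=> X1 Y1 X'1 Y'1 eqm; apply: open_quadrant_unique => a b.
have h := @cvg_mean_ray _ _ _ P X Y a b X1 Y1.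
have h' := @cvg_mean_ray _ _ _ P' X' Y' a b X'1 Y'1.
have E : (fun m => (mean P (fun t =>
      (ray_poly a m).[X t] * (ray_poly b m).[Y t]))%:E) =
    (fun m => (mean P' (fun t =>
      (ray_poly a m).[X' t] * (ray_poly b m).[Y' t]))%:E).
  by apply/funext => m; rewrite (eq_mean_poly X1 Y1 X'1 Y'1 eqm).
by rewrite E in h; apply: cvg_unique h h'.
Qed.

(** * Infinitesimal rotations *)

Section rotation.
Variables (R : realType) (D : nat).
Implicit Types (i j : 'I_D) (c s t : R).

Definition givens i j c s : 'M[R]_D :=
  1%:M + (c - 1) *: (delta_mx i i + delta_mx j j) +
  s *: (delta_mx i j - delta_mx j i).

Lemma givens_mulE m i j c s (M : 'M[R]_(D, m)) a b :
  (givens i j c s *m M) a b =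
  M a b + (a == i)%:R * ((c - 1) * M i b + s * M j b) +
  (a == j)%:R * ((c - 1) * M j b - s * M i b).
Proof.
have dE k l : (delta_mx k l *m M) a b = (a == k)%:R * M l b.
  rewrite mxE (bigD1 l) //= big1 => [|e eN]; last first.
    by rewrite mxE (negbTE eN) andbF mul0r.
  by rewrite mxE eqxx andbT addr0.
rewrite /givens !mulmxDl -!scalemxAl mulmxDl mulmxBl mul1mx.
move: (delta_mx i i *m M) (delta_mx j j *m M) (delta_mx i j *m M)
  (delta_mx j i *m M) (dE i i) (dE j j) (dE i j) (dE j i) => A1 A2 A3 A4.
by rewrite !mxE => -> -> -> ->; ring.
Qed.

(** On the plane [(i, j)] these matrices multiply like the complex numbers [c + s I], for arbitrary
    [c] and [s]. *)
Lemma givensM i j c s c' s' : i != j ->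
  givens i j c s *m givens i j c' s' =
  givens i j (c * c' - s * s') (c * s' + s * c').
Proof.
move=> ij; apply/matrixP => a b; rewrite givens_mulE /givens !mxE.
rewrite !eqxx (negbTE ij) [j == i]eq_sym (negbTE ij) /=.
have [->|ai] := eqVneq a i.
  by rewrite (negbTE ij) [i == b]eq_sym [j == b]eq_sym /=; ring.
have [->|aj] := eqVneq a j.
  by rewrite [i == b]eq_sym [j == b]eq_sym /=; ring.
by rewrite /=; ring.
Qed.

Lemma tr_givens i j c s : (givens i j c s)^T = givens i j c (- s).
Proof.
apply/matrixP => a b; rewrite /givens !mxE [b == a]eq_sym.
by rewrite ![(b == _) && _]andbC; ring.
Qed.

Lemma givens_orthogonal i j c s : i != j -> c ^+ 2 + s ^+ 2 = 1 ->
  (givens i j c s)^T *m givens i j c s = 1%:M.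
Proof.
move=> ij cs; rewrite tr_givens givensM// mulNr opprK -!expr2 cs.
rewrite mulNr [s * c]mulrC subrr /givens subrr !scale0r !addr0//.
Qed.

(** The parameter is the sine of the angle, which avoids trigonometric functions; the cosine is
    [1 + O(t^2)], so first-order terms in [t] are those of the angle. *)
Definition rot i j t := givens i j (Num.sqrt (1 - t ^+ 2)) t.

Lemma sqrt1B_itv t : 0 <= t <= 1 ->
  Num.sqrt (1 - t ^+ 2) ^+ 2 = 1 - t ^+ 2 /\
  0 <= Num.sqrt (1 - t ^+ 2) <= 1.
Proof.
move=> /andP[t0 t1]; rewrite sqr_sqrtr; last by nra.
by split=> //; rewrite sqrtr_ge0 -[leRHS]sqrtr1 ler_wsqrtr//; nra.
Qed.

Lemma rot_orthogonal i j t : i != j -> 0 <= t <= 1 ->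
  (rot i j t)^T *m rot i j t = 1%:M.
Proof.
by move=> ij /sqrt1B_itv[c2 _]; rewrite givens_orthogonal// c2 subrK.
Qed.

(* A rotation is the square of the rotation by the half angle. *)
Lemma det_rot i j t : i != j -> 0 <= t <= 1 -> \det (rot i j t) = 1.
Proof.
move=> ij /[dup] t01 /sqrt1B_itv[]; rewrite /rot.
set c := Num.sqrt _ => c2 /andP[c0 c1].
(* Half-angle formulas; [0 <= c] makes [c'] positive, so [s'] is well defined. *)
pose c' := Num.sqrt ((1 + c) / 2); pose s' := t / (2 * c').
have c'2 : c' ^+ 2 = (1 + c) / 2 by rewrite sqr_sqrtr//; lra.
have c'0 : 0 < c' by rewrite sqrtr_gt0; lra.
have s'2 : s' ^+ 2 = (1 - c) / 2.
  rewrite /s' expr_div_n exprMn c'2.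
  have -> : t ^+ 2 = (1 - c) * (1 + c) by move: c2; lra.
  by field; apply/eqP; lra.
have c's' : 2 * (c' * s') = t by rewrite /s'; field; rewrite gt_eqF.
have -> : givens i j c t = givens i j c' s' *m givens i j c' s'.
  rewrite givensM// -!expr2 c'2 s'2; congr givens; first by field.
  by rewrite -c's'; ring.
(* Transposing one of the two equal factors turns the squared determinant into the determinant of
   the identity. *)
rewrite det_mulmx -{1}det_tr -det_mulmx givens_orthogonal ?det1//.
by rewrite c'2 s'2; field.
Qed.

End rotation.

(** * First-order expansions along rotations *)

Section tangent.
Context d (T : measurableType d) (R : realType) (P : probability T R).
Variables (D m : nat) (V : T -> 'M[R]_(D, m)).
Hypothesis mV : forall a b, measurable_fun setT (fun x => V x a b).
Hypothesis V1 : forall x a b, `|V x a b| <= 1.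
Implicit Types (i j : 'I_D) (f g : 'M[R]_(D, m) -> R).

(** [g] is the derivative of [f] at [t = 0] along the rotation, taken at points of the range of [V].
    The remainder is uniform in the sample point, so that the expansion can be integrated. *)
Definition tangent i j f g :=
  [/\ bmfun (f \o V), bmfun (g \o V) &
      exists C, forall t x, 0 <= t <= 1 ->
        `|f (rot i j t *m V x) - f (V x) - t * g (V x)| <= C * t ^+ 2].

Lemma bmfun_coord a b : bmfun (fun x => V x a b).
Proof. by split => //; exists 1. Qed.

Lemma tangent_cst i j (c : R) : tangent i j (fun=> c) (fun=> 0).
Proof.
split; [exact: bmfun_cst|exact: bmfun_cst|exists 0 => t x _].
by rewrite mulr0 mul0r subr0 subrr normr0.
Qed.

Lemma tangent_coord i j a b : tangent i j (fun M => M a b)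
  (fun M => (a == i)%:R * M j b - (a == j)%:R * M i b).
Proof.
split; first exact: bmfun_coord.
  apply: (@bmfunD _ _ _ (fun x => _ * V x j b) (fun x => - (_ * V x i b))).
    exact/bmfunZ/bmfun_coord.
  under eq_fun do rewrite -mulNr; exact/bmfunZ/bmfun_coord.
exists 2 => t x t01; have [c2 /andP[c0 c1]] := sqrt1B_itv t01.
rewrite givens_mulE; set c := Num.sqrt _ in c2 c0 c1 *.
rewrite [X in `|X|](_ : _ = (c - 1) * ((a == i)%:R * V x i b) +
  (c - 1) * ((a == j)%:R * V x j b)); last by ring.
(* As [0 <= c <= 1], [1 - c <= 1 - c ^+ 2 = t ^+ 2]. *)
have c1t : `|c - 1| <= t ^+ 2 by rewrite ler0_norm; nra.
have B k : `|(a == k)%:R * V x k b| <= 1.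
  by case: eqP => _; rewrite ?mul1r// mul0r normr0.
have -> : 2 * t ^+ 2 = t ^+ 2 + t ^+ 2 by ring.
rewrite (le_trans (ler_normD _ _))// lerD// normrM;
  by rewrite -[leRHS]mulr1 ler_pM.
Qed.

Lemma tangentD i j f f' g g' : tangent i j f g -> tangent i j f' g' ->
  tangent i j (fun M => f M + f' M) (fun M => g M + g' M).
Proof.
move=> [bf bg [C fg]] [bf' bg' [C' fg']].
split; [exact: bmfunD|exact: bmfunD|exists (C + C') => t x t01].
rewrite [X in `|X|](_ : _ = (f (rot i j t *m V x) - f (V x) - t * g (V x)) +
  (f' (rot i j t *m V x) - f' (V x) - t * g' (V x))); last by ring.
by rewrite (le_trans (ler_normD _ _))// mulrDl lerD ?fg ?fg'.
Qed.

Lemma tangentM i j f f' g g' : tangent i j f g -> tangent i j f' g' ->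
  tangent i j (fun M => f M * f' M) (fun M => g M * f' M + f M * g' M).
Proof.
move=> [bf bg [C fg]] [bf' bg' [C' fg']].
split; [exact: bmfunM|by apply: bmfunD; exact: bmfunM|].
have [[_ [F fF]] [_ [G gG]]] := (bf, bg).
have [[_ [F' fF']] [_ [G' gG']]] := (bf', bg').
(* Leibniz rule: one term for each part of the remainder of the product, namely [r] times the
   rotated [f'], the linear part of [f] times [r'], and the product of the two derivatives. *)
exists (C * (F' + G' + C') + (F + G) * C' + G * G') => t x t01.
have := fg t x t01; have := fg' t x t01.
set r' := f' _ - _ - _; set r := f _ - _ - _ => r'C rC.
rewrite [X in `|X|](_ : _ = r * (f' (V x) + t * g' (V x) + r') +
  (f (V x) + t * g (V x)) * r' + t ^+ 2 * (g (V x) * g' (V x))); last first.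
  by rewrite /r /r'; ring.
have := fF x; have := gG x; have := fF' x; have := gG' x => /=.
case/andP: t01 => t0 t1 gG'x fF'x gGx fFx.
have C0 : 0 <= C.
  by have := fg 1 x; rewrite expr1n mulr1 ler01 lexx => /(_ isT);
    apply: le_trans.
have C'0 : 0 <= C'.
  by have := fg' 1 x; rewrite expr1n mulr1 ler01 lexx => /(_ isT);
    apply: le_trans.
have tt : t ^+ 2 <= 1 by rewrite exprn_ile1.
have lin h k (A B : R) : `|h| <= A -> `|k| <= B -> `|h + t * k| <= A + B.
  move=> hA kB; rewrite (le_trans (ler_normD _ _))// lerD// normrM ger0_norm//.
  by rewrite (le_trans _ kB)// ler_piMl.
rewrite [leRHS]mulrDl [X in _ <= X + _]mulrDl.
apply: le_trans (ler_normD _ _) _; apply: lerD; last first.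
  rewrite mulrC normrM (ger0_norm (exprn_ge0 2 t0)) ler_wpM2r ?exprn_ge0//.
  by rewrite normrM ler_pM.
apply: le_trans (ler_normD _ _) _; apply: lerD; last first.
  by rewrite -[leRHS]mulrA normrM ler_pM// lin.
rewrite mulrAC normrM ler_pM//.
apply: le_trans (ler_normD _ _) _; apply: lerD; first exact: lin.
by rewrite (le_trans r'C)// ler_piMr.
Qed.

Lemma eq_tangent i j f g g' : (forall x, g (V x) = g' (V x)) ->
  tangent i j f g -> tangent i j f g'.
Proof.
move=> gg' [bf bg [C fg]]; split => //.
  by rewrite (_ : g' \o V = g \o V)//; apply/funext => x /=; rewrite gg'.
by exists C => t x; rewrite -gg'; exact: fg.
Qed.

(** Leibniz rule by induction. At [k = 0] the coefficient vanishes, whatever the default value of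
    [k.-1]. *)
Lemma tangentX i j f g k : tangent i j f g ->
  tangent i j (fun M => f M ^+ k) (fun M => k%:R * f M ^+ k.-1 * g M).
Proof.
move=> tfg; elim: k => [|k IH].
  rewrite (_ : (fun M => f M ^+ 0) = fun=> 1); last exact/funext.
  by apply: eq_tangent (tangent_cst i j 1) => x; rewrite !mul0r.
rewrite (_ : (fun M => _) = (fun M => f M * f M ^+ k)); last first.
  by apply/funext => M; rewrite exprS.
apply: eq_tangent (tangentM tfg IH) => x /=.
case: k {IH} => [|k] /=; first by ring.
by rewrite -(natr1 k.+1) [f _ ^+ k.+1]exprS; ring.
Qed.

Lemma tangent_sum i j I (r : seq I) (f g : I -> 'M[R]_(D, m) -> R) :
  (forall k, tangent i j (f k) (g k)) ->
  tangent i j (fun M => \sum_(k <- r) f k M) (fun M => \sum_(k <- r) g k M).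
Proof.
move=> fg; elim: r => [|k r IH].
  rewrite [X in tangent _ _ X _](_ : _ = fun=> 0); last first.
    by apply/funext => M; rewrite big_nil.
  by apply: eq_tangent (tangent_cst i j 0) => x; rewrite big_nil.
rewrite [X in tangent _ _ X _](_ : _ = fun M => f k M + \sum_(k <- r) f k M);
  last by apply/funext => M; rewrite big_cons.
by apply: eq_tangent (tangentD (fg k) IH) => x; rewrite big_cons.
Qed.

Lemma tangent_mulmx i j l (S : 'M[R]_(l, D)) a b :
  tangent i j (fun M => (S *m M) a b)
    (fun M => S a i * M j b - S a j * M i b).
Proof.
rewrite [X in tangent _ _ X _](_ : _ =
    fun M : 'M[R]_(D, m) => \sum_k S a k * M k b); last first.
  by apply/funext => M; rewrite mxE.
have := tangent_sum (index_enum 'I_D)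
  (fun k => tangentM (tangent_cst i j (S a k)) (tangent_coord i j k b)).
apply: eq_tangent => x.
have dE k l' : \sum_(k' < D) S a k' * ((k' == k)%:R * V x l' b) =
    S a k * V x l' b.
  rewrite (bigD1 k) //= big1 ?eqxx ?mul1r ?addr0 // => k' /negbTE ->.
  by rewrite mul0r mulr0.
under eq_bigr do rewrite mul0r add0r mulrBr.
by rewrite sumrB !dE.
Qed.

(** Common form of both invariances: [V] is the column vector on the sphere and the whole matrix on
    the group, and [tau] is the action of the rotation on the sample space. *)
Definition rot_invariant := forall i j t, i != j -> 0 <= t <= 1 ->
  exists tau : T -> T, [/\ measurable_fun setT tau,
    forall B, measurable B -> P (tau @^-1` B) = P B &
    forall x, V (tau x) = rot i j t *m V x].

Hypothesis invV : rot_invariant.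

Lemma mean_preserving (f : T -> R) (tau : T -> T) :
  measurable_fun setT tau -> bmfun f ->
  (forall B, measurable B -> P (tau @^-1` B) = P B) ->
  mean P (f \o tau) = mean P f.
Proof.
move=> mtau bf Ptau; rewrite /mean /Rintegral; congr fine.
have bft : bmfun (f \o tau).
  case: bf => mf [C fC]; split; first exact: measurableT_comp.
  by exists C => x; exact: fC.
have mf : measurable_fun setT (EFin \o f).
  by apply/measurable_EFinP; case: bf.
have := @integral_pushforward _ _ _ _ R tau mtau P setT (EFin \o f) mf
  (bmfun_integrable P bft) measurableT.
rewrite preimage_setT => <-; apply: eq_measure_integral => A mA _.
exact: Ptau.
Qed.

(* Rotation invariance gives [E (f (rot t V)) = E (f V)] for every [t]; compare
   the terms of order one in [t]. *)
Lemma mean_tangent i j f g : i != j -> tangent i j f g ->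
  mean P (fun x => g (V x)) = 0.
Proof.
move=> ij [bf bg [C fg]]; pose e := `|mean P (g \o V)|.
have eC t : 0 <= t <= 1 -> t * e <= C * t ^+ 2.
  move=> t01; have [tau [mtau Ptau Vtau]] := invV ij t01.
  have bft : bmfun (f \o V \o tau).
    case: bf => mf [F fF]; split; first exact: measurableT_comp.
    by exists F => x; exact: fF.
  pose r x := (f \o V \o tau) x + (-1 * (f \o V) x + - t * (g \o V) x).
  have br : bmfun r by apply: bmfunD => //; apply: bmfunD; exact: bmfunZ.
  have rC x : `|r x| <= C * t ^+ 2.
    by have := fg t x t01; rewrite /r /= Vtau mulN1r mulNr addrA.
  have := norm_mean_le P br rC.
  rewrite /r meanD//; last by apply: bmfunD; exact: bmfunZ.
  rewrite meanD; [|exact: bmfunZ|exact: bmfunZ]; rewrite !meanZ//.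
  rewrite mean_preserving// mulN1r addrA subrr add0r mulNr normrN normrM.
  by rewrite ger0_norm//; case/andP: t01.
have e0 : 0 <= e by rewrite normr_ge0.
apply/eqP; rewrite -normr_eq0 -/e; apply/eqP/le_anti; rewrite e0 andbT leNgt.
apply/negP => ep.
have C0 : 0 <= C.
  by have := eC 1; rewrite expr1n mulr1 mul1r ler01 lexx => /(_ isT);
    apply: le_trans.
(* At [t = e / q] one has [C * t < q * t = e], contradicting [t * e <= C * t ^+ 2]; the summand [e]
   in [q] keeps [t] below 1. *)
pose q := C + 1 + e; have qp : 0 < q by rewrite /q; lra.
have t01 : 0 <= e / q <= 1.
  by rewrite divr_ge0 ?(ltW qp)//= ler_pdivrMr// /q; lra.
have := eC _ t01; set u := e / q.
have u0 : 0 < u by rewrite divr_gt0.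
have uq : u * q = e by rewrite divfK// gt_eqF.
rewrite -subr_ge0 [X in 0 <= X](_ : _ = u * (C * u - e)); last by ring.
by rewrite pmulr_rge0// -uq /q; nra.
Qed.

End tangent.

(** * Moment recurrences *)

Definition qform (R : realType) D (S : 'M[R]_D) (v : 'cV[R]_D) : R :=
  \sum_k v k 0 * (S *m v) k 0.

(** * Moments of two quadratic forms of a random unit vector *)

Section quadratic_forms.
Context d (T : measurableType d) (R : realType) (P : probability T R).
Variables (D : nat) (V : T -> 'cV[R]_D).
Hypothesis mV : forall a b, measurable_fun setT (fun x => V x a b).
Hypothesis V1 : forall x a b, `|V x a b| <= 1.
Hypothesis unitV : forall x, \sum_k V x k 0 ^+ 2 = 1.

(** The velocity of [v] is [w = v_j e_i - v_i e_j]; by symmetry of [S] the derivative of [<v, S v>]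
    is [2 <w, S v>]. *)
Lemma tangent_qform i j (S : 'M[R]_D) : S^T = S ->
  tangent V i j (qform S)
    (fun v => 2 * ((S *m v) i 0 * v j 0 - (S *m v) j 0 * v i 0)).
Proof.
move=> symS.
have := tangent_sum (index_enum 'I_D) (fun k => tangentM
  (tangent_coord mV V1 i j k 0) (tangent_mulmx mV V1 i j S k 0)).
apply: eq_tangent => x; set v := V x.
have dE l (F : 'I_D -> R) c : \sum_k (k == l)%:R * c * F k = c * F l.
  rewrite (bigD1 l) //= big1 ?eqxx ?mul1r ?addr0 // => k /negbTE ->.
  by rewrite !mul0r.
have SE l : \sum_k v k 0 * S k l = (S *m v) l 0.
  by rewrite mxE; apply: eq_bigr => k _; rewrite -{1}symS mxE mulrC.
transitivity (\sum_k ((k == i)%:R * v j 0 * (S *m v) k 0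
    - (k == j)%:R * v i 0 * (S *m v) k 0
    + (v j 0 * (v k 0 * S k i) - v i 0 * (v k 0 * S k j)))).
  by apply: eq_bigr => k _; ring.
rewrite big_split /= !sumrB !dE -!mulr_sumr !SE; ring.
Qed.

Lemma bmfun_qform (S : 'M[R]_D) : bmfun (fun x => qform S (V x)).
Proof.
apply: bmfun_sum => k _; apply: bmfunM; first exact: bmfun_coord.
under eq_fun do rewrite mxE.
by apply: bmfun_sum => l _; exact/bmfunZ/bmfun_coord.
Qed.

Hypothesis invV : rot_invariant P V.
Variables S S' : 'M[R]_D.
Hypotheses (symS : S^T = S) (symS' : S'^T = S') (trS : \tr S = 0).
Hypothesis unitS : forall x, \sum_k (S *m V x) k 0 ^+ 2 = 1.
Hypothesis orthSS' : forall x,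
  \sum_k (S *m V x) k 0 * (S' *m V x) k 0 = 0.

(* With [L i j] the infinitesimal rotation of the plane [(i, j)], this is
   [\sum_(i, j) E (L i j f_ij) = 0] for [f_ij v = (S v)_i v_j X^a Y^b], where
   [X] and [Y] are the two quadratic forms. *)
Lemma qform_moment_rec a b :
  (D + 2 * (a + b))%:R *
    mean P (fun x => qform S (V x) ^+ a.+1 * qform S' (V x) ^+ b) =
  (2 * a)%:R * mean P (fun x => qform S (V x) ^+ a.-1 * qform S' (V x) ^+ b).
Proof.
pose G i j (v : 'cV[R]_D) : R :=
  let p k := (S *m v) k 0 in let r k := (S' *m v) k 0 in
  let X := qform S v in let Y := qform S' v in
  ((S i i * v j 0 - S i j * v i 0) * v j 0 +
   p i * ((j == i)%:R * v j 0 - v i 0)) * (X ^+ a * Y ^+ b) +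
  p i * v j 0 *
   (a%:R * X ^+ a.-1 * (2 * (p i * v j 0 - p j * v i 0)) * Y ^+ b +
    X ^+ a * (b%:R * Y ^+ b.-1 * (2 * (r i * v j 0 - r j * v i 0)))).
have tG i j : tangent V i j
    (fun v => (S *m v) i 0 * v j 0 * (qform S v ^+ a * qform S' v ^+ b))
    (G i j).
  have := tangentM
    (tangentM (tangent_mulmx mV V1 i j S i 0) (tangent_coord mV V1 i j j 0))
    (tangentM (tangentX a (tangent_qform i j symS))
              (tangentX b (tangent_qform i j symS'))).
  by apply: eq_tangent => x; rewrite /G /= eqxx mul1r.
have mG i j : mean P (fun x => G i j (V x)) = 0.
  (* There is no rotation for [i = j], but there [G] vanishes identically. *)
  have [ij|ij] := eqVneq i j; last exact: mean_tangent (tG i j).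
  rewrite -[RHS](mean_cst P 0); congr mean; apply/funext => x.
  by rewrite /G ij eqxx /=; ring.
have bG i j : bmfun (fun x => G i j (V x)) by have [] := tG i j.
have bS := bmfun_qform S; have bS' := bmfun_qform S'.
have bm k l : bmfun (fun x => qform S (V x) ^+ k * qform S' (V x) ^+ l).
  by apply: bmfunM; exact: bmfunX.
(* With [\tr S = 0], [|v| = |S v| = 1] and [<S v, S' v> = 0], differentiating the prefactor gives
   [- D X^(a+1) Y^b], differentiating [X ^+ a] gives [2 a X^(a-1) (1 - X^2) Y^b], and
   differentiating [Y ^+ b] gives [- 2 b X^(a+1) Y^b]. *)
have sumG x : \sum_i \sum_j G i j (V x) =
    (2 * a)%:R * (qform S (V x) ^+ a.-1 * qform S' (V x) ^+ b) +
    - (D + 2 * (a + b))%:R * (qform S (V x) ^+ a.+1 * qform S' (V x) ^+ b).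
  set v := V x; set X := qform S v; set Y := qform S' v.
  pose p k := (S *m v) k 0; pose r k := (S' *m v) k 0; pose q k := v k 0.
  pose c1 := a%:R * X ^+ a.-1 * Y ^+ b * 2.
  pose c2 := X ^+ a * (b%:R * Y ^+ b.-1 * 2).
  have dbl (A B : 'I_D -> R) :
    \sum_i \sum_j A i * B j = (\sum_i A i) * (\sum_j B j).
    by rewrite big_distrl; apply: eq_bigr => i _; rewrite big_distrr.
  (* Each summand is now a function of [i] times a function of [j], to be summed by [dbl], except
     those with [S i j] and with the Kronecker symbol, treated in [X2] and [X3]. *)
  transitivity (\sum_i \sum_j (
     (X ^+ a * Y ^+ b * S i i) * (q j ^+ 2)
     - (X ^+ a * Y ^+ b) * (q i * (S i j * q j))
     + ((X ^+ a * Y ^+ b) * ((j == i)%:R * (p i * q j))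
     - (X ^+ a * Y ^+ b * (q i * p i)) * 1)
     + ((c1 * p i ^+ 2) * (q j ^+ 2) - (c1 * (q i * p i)) * (q j * p j)
     + ((c2 * (p i * r i)) * (q j ^+ 2) - (c2 * (q i * p i)) * (q j * r j))))).
    apply: eq_bigr => i _; apply: eq_bigr => j _.
    rewrite /G /= /c1 /c2 /p /r /q /X /Y /v; ring.
  have X2 : \sum_i \sum_j (X ^+ a * Y ^+ b) * (q i * (S i j * q j)) =
      X ^+ a * Y ^+ b * \sum_i q i * p i.
    rewrite mulr_sumr; apply: eq_bigr => i _.
    by rewrite /p mxE !mulr_sumr.
  have X3 : \sum_i \sum_j (X ^+ a * Y ^+ b) * ((j == i)%:R * (p i * q j)) =
      X ^+ a * Y ^+ b * \sum_i q i * p i.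
    rewrite mulr_sumr; apply: eq_bigr => i _.
    rewrite (bigD1 i) //= big1 ?addr0 ?eqxx ?mul1r 1?[p i * _]mulrC//.
    by move=> j /negbTE ->; rewrite mul0r mulr0.
  have sq2 : \sum_k q k ^+ 2 = 1 by exact: unitV.
  have sp2 : \sum_k p k ^+ 2 = 1 by exact: unitS.
  have spr : \sum_k p k * r k = 0 by exact: orthSS'.
  have sqp : \sum_k q k * p k = X by [].
  have sqr : \sum_k q k * r k = Y by [].
  have s1 : \sum_(k < D) (1 : R) = D%:R by rewrite sumr_const card_ord.
  have str : \sum_k S k k = 0 by exact: trS.
  under eq_bigr do rewrite !(big_split, sumrN) /=.
  rewrite !(big_split, sumrN) /= X2 X3 !dbl -!mulr_sumr.
  rewrite sq2 sp2 spr sqp sqr s1 str /c1 /c2 (natrM _ 2 a) (natrD _ D).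
  rewrite (natrM _ 2 (a + b)) (natrD _ a b).
  rewrite [X ^+ a.+1]exprS.
  (* For [a = 0] the exponent [a.-1] is the default 0, but both sides vanish. *)
  have Xa : a%:R * X ^+ a.-1 * X ^+ 2 = a%:R * (X ^+ a * X).
    by case: (a) => [|k] /=; rewrite ?mul0r// !exprS; ring.
  have Yb : b%:R * Y ^+ b.-1 * Y = b%:R * Y ^+ b.
    by case: (b) => [|k] /=; rewrite ?mul0r// !exprS; ring.
  have -> : a%:R * X ^+ a.-1 * Y ^+ b * 2 * X * X =
    a%:R * X ^+ a.-1 * X ^+ 2 * (Y ^+ b * 2) by ring.
  have -> : X ^+ a * (b%:R * Y ^+ b.-1 * 2) * X * Y =
    b%:R * Y ^+ b.-1 * Y * (X ^+ a * X * 2) by ring.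
  rewrite Xa Yb; ring.
have : mean P (fun x => \sum_i \sum_j G i j (V x)) = 0.
  rewrite mean_sum => [|i _]; last by apply: bmfun_sum.
  by apply: big1 => i _; rewrite mean_sum//; apply: big1.
under eq_fun do rewrite sumG.
rewrite meanD; [|exact: bmfunZ|exact: bmfunZ]; rewrite !meanZ// mulNr.
by move/eqP; rewrite subr_eq0 => /eqP ->.
Qed.

End quadratic_forms.

(** * Moments of two entries in the first row of a random matrix *)

Section orthogonal_columns.
Context d (T : measurableType d) (R : realType) (P : probability T R).
Variables (n m : nat) (V : T -> 'M[R]_(n.+1, m)).
Hypothesis mV : forall a b, measurable_fun setT (fun x => V x a b).
Hypothesis V1 : forall x a b, `|V x a b| <= 1.
Hypothesis invV : rot_invariant P V.
Variables k l : 'I_m.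
Hypothesis unitk : forall x, \sum_i V x i k ^+ 2 = 1.
Hypothesis orthkl : forall x, \sum_i V x i k * V x i l = 0.

(* [\sum_(j != 0) E (L 0 j f_j) = 0] for [f_j M = M j k * X^a * Y^b]. *)
Lemma column_moment_rec a b :
  (n + (a + b))%:R * mean P (fun x => V x 0 k ^+ a.+1 * V x 0 l ^+ b) =
  a%:R * mean P (fun x => V x 0 k ^+ a.-1 * V x 0 l ^+ b).
Proof.
pose G j (M : 'M[R]_(n.+1, m)) : R :=
  - (M 0 k * (M 0 k ^+ a * M 0 l ^+ b)) +
  M j k * (a%:R * M 0 k ^+ a.-1 * M j k * M 0 l ^+ b +
           M 0 k ^+ a * (b%:R * M 0 l ^+ b.-1 * M j l)).
have tG j : j != 0 -> tangent V 0 j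
    (fun M => M j k * (M 0 k ^+ a * M 0 l ^+ b)) (G j).
  move=> j0.
  have := tangentM (tangent_coord mV V1 0 j j k)
    (tangentM (tangentX a (tangent_coord mV V1 0 j 0 k))
              (tangentX b (tangent_coord mV V1 0 j 0 l))).
  apply: eq_tangent => x; rewrite /G /= !eqxx (negbTE j0) eq_sym (negbTE j0) /=.
  ring.
have bm i j : bmfun (fun x => V x 0 k ^+ i * V x 0 l ^+ j).
  by apply: bmfunM; apply: bmfunX; exact: bmfun_coord.
(* The column relations give [1 - X^2] for the sum of the [M j k ^+ 2] over [j != 0], and [- X Y]
   for that of the [M j k * M j l]. *)
have sumG x : \sum_(j < n.+1 | j != 0) G j (V x) =
    a%:R * (V x 0 k ^+ a.-1 * V x 0 l ^+ b) +
    - (n + (a + b))%:R * (V x 0 k ^+ a.+1 * V x 0 l ^+ b).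
  set M := V x; set X := M 0 k; set Y := M 0 l.
  have := unitk x; rewrite (bigD1 0) //= -/M -/X => sk.
  have := orthkl x; rewrite (bigD1 0) //= -/M -/X -/Y => skl.
  transitivity (\sum_(j < n.+1 | j != 0) (- (X ^+ a.+1 * Y ^+ b)
    + (a%:R * X ^+ a.-1 * Y ^+ b * M j k ^+ 2
    + X ^+ a * b%:R * Y ^+ b.-1 * (M j k * M j l)))).
    by apply: eq_bigr => j _; rewrite /G -/X -/Y exprS; ring.
  rewrite !big_split /= -!mulr_sumr sumr_const.
  rewrite (eqP (_ : \sum_(i < n.+1 | i != 0) M i k ^+ 2 == 1 - X ^+ 2));
    last first.
    by rewrite -sk [X in _ == X]addrC addKr.
  rewrite (eqP (_ : \sum_(i < n.+1 | i != 0) M i k * M i l == - (X * Y)));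
    last first.
    by rewrite -addr_eq0 addrC skl.
  have -> : #|(fun i : 'I_n.+1 => i != 0)| = n.
    transitivity #|predC1 (0 : 'I_n.+1)|; last by rewrite cardC1 card_ord.
    exact: eq_card.
  have Xa : a%:R * X ^+ a.-1 * X ^+ 2 = a%:R * X ^+ a.+1.
    by case: (a) => [|e] /=; rewrite ?mul0r// !exprS; ring.
  have Yb : b%:R * Y ^+ b.-1 * Y = b%:R * Y ^+ b.
    by case: (b) => [|e] /=; rewrite ?mul0r// !exprS; ring.
  rewrite mulrBr.
  have -> : a%:R * X ^+ a.-1 * Y ^+ b * X ^+ 2 =
    a%:R * X ^+ a.-1 * X ^+ 2 * Y ^+ b by ring.
  have -> : X ^+ a * b%:R * Y ^+ b.-1 * - (X * Y) =
    - (b%:R * Y ^+ b.-1 * Y * (X * X ^+ a)) by ring.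
  by rewrite Xa Yb -exprS !natrD -mulr_natl; ring.
have : mean P (fun x => \sum_(j < n.+1 | j != 0) G j (V x)) = 0.
  rewrite mean_sum => [|j j0]; last by have [] := tG j j0.
  by apply: big1 => j j0; apply: mean_tangent (tG j j0) => //; rewrite eq_sym.
under eq_fun do rewrite sumG.
rewrite meanD; [|exact: bmfunZ|exact: bmfunZ]; rewrite !meanZ// mulNr.
by move/eqP; rewrite subr_eq0 => /eqP ->.
Qed.

End orthogonal_columns.

(** * Uniqueness of the solution of the recurrences *)

Definition moment_rec (R : realType) N (M : nat -> nat -> R) :=
  (forall a b, (N + (a + b))%:R * M a.+1 b = a%:R * M a.-1 b) /\
  (forall a b, (N + (a + b))%:R * M a b.+1 = b%:R * M a b.-1).

(** Strong induction on [a + b]: the left coefficient is nonzero, and the right side involves a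
    moment of strictly smaller total degree, with coefficient 0 when the predecessor is a default
    value. *)
Lemma moment_rec_unique (R : realType) N (M M' : nat -> nat -> R) :
  moment_rec N.+1 M -> moment_rec N.+1 M' -> M 0%N 0%N = M' 0%N 0%N ->
  forall a b, M a b = M' a b.
Proof.
move=> [Ma Mb] [M'a M'b] M00 a b.
have [s] := ubnP (a + b); elim: s a b => // s IH a b abs.
case: a abs => [|a] abs.
  case: b abs => [//|b] abs; apply: (@mulfI _ (N.+1 + (0 + b))%:R).
    by rewrite pnatr_eq0.
  by rewrite Mb M'b IH//; move: abs; case: (b) => //= c; lia.
apply: (@mulfI _ (N.+1 + (a + b))%:R); first by rewrite pnatr_eq0.
by rewrite Ma M'a IH//; move: abs; case: (a) => //= c; lia.
Qed.

(** * Measurability of coordinates and of left multiplication *)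

Lemma measurable_borel_continuous (T T' : ptopologicalType) (f : T -> T') :
  continuous f -> measurable_fun [set: borel T] (f : borel T -> borel T').
Proof.
move=> /continuousP cf.
apply: (@measurability _ _ (borel T) (borel T') _ _ (@open T') erefl).
move=> _ [B oB <-].
by rewrite setTI; apply: sub_sigma_algebra; exact: cf.
Qed.

Lemma continuous_mx (X : topologicalType) (R : realType) p q
    (F : X -> 'M[R]_(p, q)) :
  (forall a b, continuous (fun x => F x a b)) -> continuous F.
Proof.
move=> cF x A [B nB sBA].
have : \forall y \near x, forall a b, B a b (F y a b).
  by apply: filter_forall => a; apply: filter_forall => b; exact: cF (nB a b).
by apply: filterS => y yB; exact: sBA.
Qed.

Lemma continuous_sval_mulmx (R : realType) D m (A : set 'M[R]_(D, m))
    (f : set_type A -> set_type A) (U : 'M[R]_D) :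
  (forall x, sval (f x) = U *m sval x) -> continuous f.
Proof.
move=> fE; apply: (@continuous_comp_initial _ _ _ (set_val : A -> _)).
rewrite (_ : _ \o f = fun x => U *m sval x); last first.
  by apply/funext => x /=; rewrite -fE.
apply: continuous_mx => a b; under eq_fun do rewrite mxE.
apply: (@continuous_big R _ +%R 0 xpredT) => [|k _ x].
  by move=> [u v]; apply: cvgD; [exact: cvg_fst|exact: cvg_snd].
apply: (@cvgM _ _ (nbhs x) _ (fun=> U a k) (fun y => sval y k b)).
  exact: cvg_cst.
apply: (@continuous_comp _ _ _ (sval : set_type A -> 'M[R]_(D, m))
  (fun M => M k b)); first exact: (@initial_continuous (set_type A) _ set_val).
exact: coord_continuous.
Qed.

Lemma measurable_coord (R : realType) D m (T : ptopologicalType)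
    (h : T -> 'M[R]_(D, m)) a b :
  continuous h -> measurable_fun [set: borel T] (fun x : borel T => h x a b).
Proof.
move=> ch; apply: continuous_borel_measurable => x.
by apply: (@continuous_comp _ _ _ h (fun M => M a b));
  [exact: ch|exact: coord_continuous].
Qed.

Lemma norm_le1_sum_sqr (R : realDomainType) (I : finType) (F : I -> R) i :
  \sum_k F k ^+ 2 = 1 -> `|F i| <= 1.
Proof.
rewrite (bigD1 i) //= => F1; rewrite -(@ler_pXn2r _ 2) ?nnegrE//.
rewrite real_normK ?num_real// expr1n -F1 lerDl sumr_ge0// => k _.
exact: sqr_ge0.
Qed.

Lemma oppmxE (V : zmodType) m p (M : 'M[V]_(m, p)) i j : (- M) i j = - M i j.
Proof. by rewrite mxE. Qed.

(** * The recurrences on the sphere *)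

Section sphere_moments.
Variables (R : realType) (n : nat).
Notation V := (fun p : borel (sphere R n.+1) => sval p).

(** The matrices of the forms [|x|^2 - |y|^2] and [2 <x, y>], which are [xi] at the identity and at
    [rho]. *)
Definition diff_mx : 'M[R]_(n.+1 + n.+1) := block_mx 1%:M 0 0 (- 1%:M).
Definition swap_mx : 'M[R]_(n.+1 + n.+1) := block_mx 0 1%:M 1%:M 0.

Lemma diff_mxE (x y : 'cV[R]_n.+1) : diff_mx *m col_mx x y = col_mx x (- y).
Proof. by rewrite mul_block_col !mul0mx mul1mx mulNmx mul1mx addr0 add0r. Qed.

Lemma swap_mxE (x y : 'cV[R]_n.+1) : swap_mx *m col_mx x y = col_mx y x.
Proof. by rewrite mul_block_col !mul0mx !mul1mx addr0 add0r. Qed.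

Lemma tr_diff_mx : diff_mx^T = diff_mx.
Proof. by rewrite tr_block_mx !trmx0 linearN /= trmx1. Qed.

Lemma tr_swap_mx : swap_mx^T = swap_mx.
Proof. by rewrite tr_block_mx !trmx0 trmx1. Qed.

Lemma trace_diff_mx : \tr diff_mx = 0.
Proof. by rewrite mxtrace_block linearN /= subrr. Qed.

Lemma trace_swap_mx : \tr swap_mx = 0.
Proof. by rewrite mxtrace_block !linear0 addr0. Qed.

(** A binary [F] serves inner products and, when it ignores its second argument, sums of squares. *)
Lemma sum_col_mx (F : R -> R -> R) (x y x' y' : 'cV[R]_n.+1) :
  \sum_k F (col_mx x y k 0) (col_mx x' y' k 0) =
  \sum_i F (x i 0) (x' i 0) + \sum_i F (y i 0) (y' i 0).
Proof.
rewrite big_split_ord /=; congr (_ + _); apply: eq_bigr => i _.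
  by rewrite !col_mxEu.
by rewrite !col_mxEd.
Qed.

Lemma sphere_sum p : \sum_k V p k 0 ^+ 2 = 1.
Proof. by have := svalP p; rewrite inE. Qed.

Lemma diff_sum p : \sum_k (diff_mx *m V p) k 0 ^+ 2 = 1.
Proof.
rewrite -[RHS](sphere_sum p) -[V p]vsubmxK diff_mxE.
rewrite !(sum_col_mx (fun u _ => u ^+ 2) _ _ 0 0); congr (_ + _).
by apply: eq_bigr => i _; rewrite mxE sqrrN.
Qed.

Lemma swap_sum p : \sum_k (swap_mx *m V p) k 0 ^+ 2 = 1.
Proof.
rewrite -[RHS](sphere_sum p) -[V p]vsubmxK swap_mxE.
by rewrite !(sum_col_mx (fun u _ => u ^+ 2) _ _ 0 0) addrC.
Qed.

Lemma diff_swap_orth p :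
  \sum_k (diff_mx *m V p) k 0 * (swap_mx *m V p) k 0 = 0.
Proof.
rewrite /= -[sval p]vsubmxK swap_mxE diff_mxE (sum_col_mx (fun u v => u * v)).
rewrite -big_split big1 //= => i _. rewrite oppmxE; ring.
Qed.

Lemma qform_diffE (x y : 'cV[R]_n.+1) :
  qform diff_mx (col_mx x y) = \sum_i x i 0 ^+ 2 - \sum_i y i 0 ^+ 2.
Proof.
rewrite /qform diff_mxE (sum_col_mx (fun u v => u * v)); congr (_ + _).
rewrite -sumrN; apply: eq_bigr => i _; rewrite oppmxE; ring.
Qed.

Lemma qform_swapE (x y : 'cV[R]_n.+1) :
  qform swap_mx (col_mx x y) = \sum_i x i 0 * y i 0 *+ 2.
Proof.
rewrite /qform swap_mxE (sum_col_mx (fun u v => u * v)) -big_split.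
by apply: eq_bigr => i _ /=; rewrite [y i 0 * _]mulrC mulr2n.
Qed.

Lemma xi1E p : xi (orthogonal1 R (n.+1 + n.+1)) p = qform diff_mx (V p).
Proof. by rewrite /xi /= mul1mx -qform_diffE vsubmxK. Qed.

(** Coordinatewise, [(x + y)^2 / 2 - (y - x)^2 / 2 = 2 x y]. *)
Lemma xi_rhoE p : xi (rho R n.+1) p = qform swap_mx (V p).
Proof.
rewrite /xi /= -[in RHS](vsubmxK (V p)) qform_swapE.
have -> : rho_mx R n.+1 *m sval p = (Num.sqrt 2)^-1 *:
    col_mx (usubmx (sval p) + dsubmx (sval p))
           (dsubmx (sval p) - usubmx (sval p)).
  rewrite -scalemxAl -[in LHS](vsubmxK (sval p)) mul_block_col.
  by rewrite mulNmx !mul1mx [- _ + _]addrC.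
rewrite linearZ /= [dsubmx (_ *: _)]linearZ /= col_mxKu col_mxKd -sumrB.
apply: eq_bigr => i _ /=; rewrite !mxE.
have s2 : (Num.sqrt 2)^-1 ^+ 2 = 2^-1 :> R by rewrite exprVn sqr_sqrtr.
by rewrite !exprMn s2; field.
Qed.

Lemma sphere_coord_le1 p a b : `|V p a b| <= 1.
Proof.
rewrite (ord1 b); exact: norm_le1_sum_sqr (sphere_sum p).
Qed.

Lemma measurable_sphere_coord a b : measurable_fun setT (fun p => V p a b).
Proof.
apply: measurable_coord.
exact: (@initial_continuous (set_type (sphere_set R _)) _ set_val).
Qed.

Lemma sphere_rot_invariant mu : is_uniform mu -> rot_invariant mu V.
Proof.
move=> mu_unif i j t ij t01.
have U0 : rot i j t \in orthogonal_set R (n.+1 + n.+1).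
  by rewrite inE; exact: rot_orthogonal.
pose U : orthogonal_group R (n.+1 + n.+1) := SigSub U0.
exists (sphere_act U); split => //; last by move=> B mB; exact: mu_unif.
by apply: measurable_borel_continuous; exact: continuous_sval_mulmx.
Qed.

Lemma xi_moment_rec mu : is_uniform mu -> moment_rec n.+1 (fun a b =>
  mean mu (fun p => xi (orthogonal1 R (n.+1 + n.+1)) p ^+ a *
                    xi (rho R n.+1) p ^+ b)).
Proof.
move=> mu_unif; have inv := sphere_rot_invariant mu_unif.
(* The ambient dimension is [2 (n + 1)], so a factor 2 cancels; this produces the coefficient found
   on the group. *)
have half e (M M' : R) k :
    (n.+1 + n.+1 + 2 * e)%:R * M = (2 * k)%:R * M' ->
    (n.+1 + e)%:R * M = k%:R * M'.
  rewrite (_ : (_ + _ + _)%N = 2 * (n.+1 + e))%N; last by lia.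
  by rewrite !natrM -!mulrA => /(mulfI _); apply; rewrite pnatr_eq0.
have xiE a b : mean mu (fun p => xi (orthogonal1 R (n.+1 + n.+1)) p ^+ a *
      xi (rho R n.+1) p ^+ b) =
    mean mu (fun p => qform diff_mx (V p) ^+ a * qform swap_mx (V p) ^+ b).
  by congr mean; apply/funext => p; rewrite xi1E xi_rhoE.
split=> a b; rewrite !xiE; apply: half.
  exact: (qform_moment_rec measurable_sphere_coord sphere_coord_le1 sphere_sum
    inv tr_diff_mx tr_swap_mx trace_diff_mx diff_sum diff_swap_orth).
(* The second recurrence is the first one with the two matrices exchanged. *)
have comm u v : mean mu (fun p => qform diff_mx (V p) ^+ u *
      qform swap_mx (V p) ^+ v) =
    mean mu (fun p => qform swap_mx (V p) ^+ v * qform diff_mx (V p) ^+ u).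
  by congr mean; apply/funext => p; rewrite mulrC.
rewrite !comm (addnC a).
apply: (qform_moment_rec measurable_sphere_coord sphere_coord_le1 sphere_sum
    inv tr_swap_mx tr_diff_mx trace_swap_mx swap_sum) => p.
by rewrite -[RHS](diff_swap_orth p); apply: eq_bigr => k _; rewrite mulrC.
Qed.

(** The rotated point is on the sphere, so [xi] is a difference of two nonnegative numbers of sum
    1. *)
Lemma xi_le1 U (p : borel (sphere R n.+1)) : `|xi U p| <= 1.
Proof.
have := svalP (sphere_act U p); rewrite inE /sphere_set /= /xi /=.
set q := _ *m _ => q1; set x := \sum_i usubmx q i 0 ^+ 2.
set y := \sum_i dsubmx q i 0 ^+ 2.
have xy : x + y = 1.
  rewrite -q1 big_split_ord; congr (_ + _);
    by apply: eq_bigr => i _; rewrite mxE.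
have x0 : 0 <= x by apply: sumr_ge0 => i _; exact: sqr_ge0.
have y0 : 0 <= y by apply: sumr_ge0 => i _; exact: sqr_ge0.
rewrite ler_norml; lra.
Qed.

End sphere_moments.

(** * The recurrences on the special orthogonal group *)

Section SO_moments.
Variables (R : realType) (n : nat).
Notation V := (fun g : borel (SO R n.+2) => sval g).

Lemma SO_orth (g : SO R n.+2) k l :
  \sum_i sval g i k * sval g i l = (k == l)%:R.
Proof.
have := svalP g; rewrite inE => -[/matrixP/(_ k l) + _].
by rewrite !mxE => <-; apply: eq_bigr => i _; rewrite mxE.
Qed.

Lemma SO_sum (g : SO R n.+2) k : \sum_i sval g i k ^+ 2 = 1.
Proof. by under eq_bigr do rewrite expr2; rewrite SO_orth eqxx. Qed.

Lemma SO_coord_le1 (g : borel (SO R n.+2)) a b : `|V g a b| <= 1.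
Proof. exact: (norm_le1_sum_sqr (F := fun a => V g a b) a (SO_sum g b)). Qed.

(** Plane rotations have determinant 1, hence lie in the group, and left invariance applies to
    them. *)
Lemma SO_rot_invariant nu : is_Haar nu -> rot_invariant nu V.
Proof.
move=> nu_Haar i j t ij t01.
have g0 : rot i j t \in SO_set R n.+2.
  by rewrite inE; split; [exact: rot_orthogonal|exact: det_rot].
pose g : SO R n.+2 := SigSub g0.
exists (SO_mul g); split => //; last by move=> B mB; exact: nu_Haar.
by apply: measurable_borel_continuous; exact: continuous_sval_mulmx.
Qed.

Lemma SO_coord_moment_rec nu (k l : 'I_n.+2) : k != l -> is_Haar nu ->
  moment_rec n.+1 (fun a b => mean nu (fun g : borel (SO R n.+2) =>
    SO_coord 0 k g ^+ a * SO_coord 0 l g ^+ b)).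
Proof.
move=> kl nu_Haar; have inv := SO_rot_invariant nu_Haar.
have mV a b : measurable_fun setT (fun g => V g a b).
  exact: measurable_SO_coord.
split=> a b.
  apply: (column_moment_rec mV SO_coord_le1 inv (SO_sum^~ k)) => g.
  by rewrite SO_orth (negbTE kl).
have comm u v : mean nu (fun g : borel (SO R n.+2) =>
      SO_coord 0 k g ^+ u * SO_coord 0 l g ^+ v) =
    mean nu (fun g : borel (SO R n.+2) =>
      SO_coord 0 l g ^+ v * SO_coord 0 k g ^+ u).
  by congr mean; apply/funext => g; rewrite mulrC.
rewrite !comm (addnC a).
apply: (column_moment_rec mV SO_coord_le1 inv (SO_sum^~ l)) => g.
by rewrite SO_orth eq_sym (negbTE kl).
Qed.

End SO_moments.

(* n.+1 is the integer n >= 1 of the text: the sphere is S^{2(n+1)-1}, the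
   group is SO_{n+2}, and u_{11}, u_{12} have 0-based indices (0,0), (0,1). *)
Theorem theorem9p6 (R : realType) (n : nat)
    (mu : probability (borel (sphere R n.+1)) R) (mu_unif : is_uniform mu)
    (nu : probability (borel (SO R n.+2)) R) (nu_Haar : is_Haar nu)
    (A : set (R * R)) (mA : measurable A) :
  distribution mu (joint (xi (orthogonal1 R (n.+1 + n.+1))) (xi (rho R n.+1))) A =
  distribution nu (joint (SO_coord (0 : 'I_n.+2) 0) (SO_coord (0 : 'I_n.+2) 1)) A.
Proof.
apply: eq_distribution_moments => //.
- by move=> p; exact: xi_le1.
- by move=> p; exact: xi_le1.
- by move=> g; exact: SO_coord_le1.
- by move=> g; exact: SO_coord_le1.
apply: moment_rec_unique (xi_moment_rec mu_unif) _ _.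
- exact: SO_coord_moment_rec.
(* Both sequences start at 1, the total mass. *)
- have one d (T : measurableType d) (P : probability T R) (f g : T -> R) :
    mean P (fun x => f x ^+ 0 * g x ^+ 0) = 1.
    by under eq_fun do rewrite !expr0 mulr1; exact: mean_cst.
  by rewrite !one.
Qed.
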